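(* For a financial market with price process $(S_t)_{0\le t\le T}$ on a Dedekind complete Riesz space $E$ with filtration $(\mathbb{F}_t)_{0\le t\le T}$, the following statements are equivalent. (i) The AIP (absence of immediate profit) condition holds. (ii) For any $t\leq T$ and any $v_{t,T}\in\mathcal{V}_{t,T}$, $m_{\mathbb{F}_{t}}(v_{t,T})\leq 0$.
   Context: $E$ is a Dedekind complete Riesz space with weak order unit $e$; $E^{u}$ is its universal completion, an $f$-algebra with unit $e$, in which products are taken. A conditional expectation on $E$ is a strictly positive order continuous linear projection $\mathbb{F}$ with $\mathbb{F}e=e$ whose range is a Dedekind complete Riesz subspace. It extends uniquely to a conditional expectation, still denoted $\mathbb{F}$, on its natural domain $\mathcal{L}^{1}(\mathbb{F})$, the largest Riesz subspace of $E^{u}$ to which $\mathbb{F}$ so extends (its positive elements are those $z\in E^{u}_{+}$ for which there is a net $0\le x_\alpha\uparrow z$ in $E$ with $(\mathbb{F}x_\alpha)$ order bounded in $E^{u}$, and then $\mathbb{F}z=\sup_\alpha\mathbb{F}x_\alpha$). $R(\mathbb{F})$ is the range of this extension (a universally complete $f$-subalgebra of $E^{u}$); $R(\mathbb{F})^{-}$ is the set of its elements $\leq 0$. $\mathcal{L}^{\infty}(\mathbb{F})$ is the ideal of $E^{u}$ generated by $R(\mathbb{F})$; for $f\in\mathcal{L}^{\infty}(\mathbb{F})$, $m_{\mathbb{F}}(f)=\sup\{g\in R(\mathbb{F}): g\leq f\}$. For general $v\in E^{u}$ the inequality $m_{\mathbb{F}}(v)\leq 0$ is understood to mean that every $g\in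 R(\mathbb{F})$ with $g\leq v$ satisfies $g\leq 0$ (which agrees with the definition when $v\in\mathcal{L}^{\infty}(\mathbb{F})$). Financial market: $T\geq 1$ is an integer horizon, times are $0,1,\dots,T$, and $(\mathbb{F}_t)_{0\le t\le T}$ is a filtration, i.e. a family of conditional expectations on $E$ with $\mathbb{F}_i\mathbb{F}_j=\mathbb{F}_j\mathbb{F}_i=\mathbb{F}_i$ for $i<j$ (so $R(\mathbb{F}_i)\subset R(\mathbb{F}_j)$). The price process satisfies $S_t\in R(\mathbb{F}_t)$ and $S_t\geq 0$. Put $\Delta S_i=S_i-S_{i-1}$ and $$\mathcal{V}_{t,T}=\Big\{\sum_{i=t+1}^{T}\theta_{i-1}\Delta S_i:\ \theta_i\in R(\mathbb{F}_i)\Big\}$$ (so $\mathcal{V}_{T,T}=\{0\}$). Let $P_{t,T}=\{p_t\in R(\mathbb{F}_t):\exists\, v\in\mathcal{V}_{t,T},\ p_t+v\geq 0\}$. AIP means $P_{t,T}\cap R(\mathbb{F}_t)^{-}=\{0\}$ for all $t<T$. *)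

(* Defs.v *)
From HB Require Import structures.
From mathcomp Require Import all_boot all_order all_algebra.
From mathcomp Require Import boolp classical_sets reals.

Set Implicit Arguments.
Unset Strict Implicit.
Unset Printing Implicit Defensive.

Import Order.TTheory GRing.Theory Num.Theory.
Local Open Scope classical_set_scope.
Local Open Scope ring_scope.

(* [Order.Lattice] is not a parent class here, and f-algebras do not inherit
   from [GRing.PzRing]: the joins of these classes with [Num.POrderedZmodule]
   are missing from the hierarchy below [realDomainType], and cannot be added
   afterwards.  The lattice operations are therefore in the mixin, with an
   [Order.Lattice] instance declared on top of it, and the multiplication of an
   f-algebra is an explicit operation. *)
HB.mixin Record isRiesz (R : realType) E
    of GRing.Lmodule R E & Num.POrderedZmodule E := {
  rmeet : E -> E -> E ;
  rjoin : E -> E -> E ;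
  rmeetP : forall x y z : E, (x <= rmeet y z) = (x <= y) && (x <= z) ;
  rjoinP : forall x y z : E, (rjoin x y <= z) = (x <= z) && (y <= z) ;
  riesz_leD2r : forall z x y : E, x <= y -> x + z <= y + z ;
  riesz_scale_ge0 : forall (a : R) (x : E), 0 <= a -> 0 <= x -> 0 <= a *: x
}.

#[short(type="rieszType")]
HB.structure Definition Riesz (R : realType) :=
  { E of GRing.Lmodule R E & Num.POrderedZmodule E & isRiesz R E }.

HB.instance Definition _ (R : realType) (E : rieszType R) :=
  @Order.POrder_MeetJoin_isLattice.Build ring_display E
    (@rmeet R E) (@rjoin R E) (@rmeetP R E) (@rjoinP R E).

Record f_algebra (R : realType) (A : rieszType R) (one : A)
    (mul : A -> A -> A) : Prop := FAlgebra {
  falg_mulA : associative mul ;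
  falg_mul1l : left_id one mul ;
  falg_mul1r : right_id one mul ;
  falg_linearl : forall y, linear (mul^~ y) ;
  falg_linearr : forall x, linear (mul x) ;
  falg_mul_ge0 : forall x y : A, 0 <= x -> 0 <= y -> 0 <= mul x y ;
  falg_disjl : forall x y z : A,
    (x `&` y)%O = 0 -> 0 <= z -> (mul z x `&` y)%O = 0 ;
  falg_disjr : forall x y z : A,
    (x `&` y)%O = 0 -> 0 <= z -> (mul x z `&` y)%O = 0
}.

Section RieszTheory.
Variables (R : realType) (E : rieszType R).
Implicit Types (A B D : set E) (x y e : E).

Definition rabs x : E := (x `|` (- x))%O.
Definition rpos x : E := (x `|` 0)%O.
Definition rneg x : E := ((- x) `|` 0)%O.

Definition linear_subspace A : Prop :=
  A 0 /\ forall (a : R) x y, A x -> A y -> A (a *: x + y).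

Definition riesz_subspace A : Prop :=
  linear_subspace A /\
  forall x y, A x -> A y -> A (x `|` y)%O /\ A (x `&` y)%O.

(* Bounds and suprema are those of [A] with the induced order; the Dedekind
   completeness of [E] itself is [dedekind_complete [set: E]]. *)
Definition dedekind_complete A : Prop :=
  forall D, D `<=` A -> D !=set0 -> (exists2 b, A b & ubound D b) ->
    exists s, [/\ A s, ubound D s & forall b, A b -> ubound D b -> s <= b].

Definition laterally_complete : Prop :=
  forall D, D !=set0 -> (forall x, D x -> 0 <= x) ->
    (forall x y, D x -> D y -> x <> y -> (x `&` y)%O = 0) ->
    exists s, supremums D s.

Definition universally_complete : Prop :=
  dedekind_complete [set: E] /\ laterally_complete.

Definition ideal A : Prop :=
  linear_subspace A /\ forall x y, A y -> rabs x <= rabs y -> A x.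

Definition band A : Prop :=
  ideal A /\ forall D s, D `<=` A -> supremums D s -> A s.

(* The band generated by [e] is the whole space. *)
Definition weak_order_unit e : Prop :=
  0 <= e /\ forall B, band B -> B e -> B = [set: E].

End RieszTheory.

Definition directed (I : Type) (leI : I -> I -> Prop) : Prop :=
  [/\ inhabited I, (forall i, leI i i),
      (forall i k l, leI i k -> leI k l -> leI i l) &
      (forall i k, exists l, leI i l /\ leI k l)].

Section Nets.
Variables (R : realType) (E : rieszType R).

Definition order_cvg (I : Type) (leI : I -> I -> Prop) (x : I -> E) (l : E) :
    Prop :=
  exists (J : Type) (leJ : J -> J -> Prop) (y : J -> E),
    [/\ directed leJ,
        (forall b c, leJ b c -> y c <= y b),
        infimums (range y) 0 &
        (forall b, exists i0, forall i, leI i0 i -> rabs (x i - l) <= y b)].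

Definition order_continuous (F : E -> E) : Prop :=
  forall (I : Type) (leI : I -> I -> Prop) (x : I -> E) (l : E),
    directed leI -> order_cvg leI x l -> order_cvg leI (F \o x) (F l).

End Nets.

(* [j] identifies [E] with an order dense Riesz subspace of [Eu]. *)
Definition universal_completion (R : realType) (E Eu : rieszType R)
    (j : {linear E -> Eu}) : Prop :=
  [/\ universally_complete Eu,
      injective j,
      (forall x y : E, j (x `|` y)%O = (j x `|` j y)%O),
      (forall x y : E, j (x `&` y)%O = (j x `&` j y)%O) &
      (forall u : Eu, 0 < u -> exists2 x : E, 0 < j x & j x <= u)].

Definition conditional_expectation (R : realType) (E : rieszType R) (e : E)
    (F : {linear E -> E}) : Prop :=
  [/\ (forall x : E, 0 < x -> 0 < F x),
      order_continuous F,
      (forall x : E, F (F x) = F x),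
      F e = e &
      riesz_subspace (range F) /\ dedekind_complete (range F)].

Section Extension.
Variables (R : realType) (E Eu : rieszType R) (j : {linear E -> Eu}).
Variable F : {linear E -> E}.

Definition net_increases_to (I : Type) (leI : I -> I -> Prop) (x : I -> E)
    (z : Eu) : Prop :=
  [/\ directed leI,
      (forall i, 0 <= x i),
      (forall i k, leI i k -> x i <= x k) &
      supremums (range (j \o x)) z].

Definition natural_domain_pos : set Eu := [set z |
  0 <= z /\
  exists (I : Type) (leI : I -> I -> Prop) (x : I -> E),
    net_increases_to leI x z /\ has_ubound (range (j \o (F \o x)))].

Definition natural_domain : set Eu := [set z |
  natural_domain_pos (rpos z) /\ natural_domain_pos (rneg z)].

(* Graphs of the extension of [F], on the positive cone and on the whole of the
   natural domain: [ext_pos z w] reads [F z = w]. *)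
Definition ext_pos (z w : Eu) : Prop :=
  exists (I : Type) (leI : I -> I -> Prop) (x : I -> E),
    net_increases_to leI x z /\ supremums (range (j \o (F \o x))) w.

Definition ext (z w : Eu) : Prop :=
  exists w1 w2, [/\ ext_pos (rpos z) w1, ext_pos (rneg z) w2 & w = w1 - w2].

Definition ext_range : set Eu := [set w |
  exists2 z, natural_domain z & ext z w].

(* [m_F(v) <= 0], where [m_F(v)] is the supremum of the elements of
   [ext_range] below [v]; meaningful for every [v], even when that supremum
   does not exist. *)
Definition cond_inf_le0 (v : Eu) : Prop :=
  forall g, ext_range g -> g <= v -> g <= 0.

End Extension.

(* Families are indexed by [nat]; only the indices up to the horizon [T]
   matter. *)
Definition filtration (R : realType) (E : rieszType R) (e : E) (T : nat)
    (F : nat -> {linear E -> E}) : Prop :=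
  (forall t, (t <= T)%N -> conditional_expectation e (F t)) /\
  (forall i k, (i < k)%N -> (k <= T)%N ->
     forall x, F i (F k x) = F i x /\ F k (F i x) = F i x).

Section Market.
Variables (R : realType) (E Eu : rieszType R) (mul : Eu -> Eu -> Eu).
Variables (j : {linear E -> Eu}) (T : nat).
Variables (F : nat -> {linear E -> E}) (S : nat -> Eu).

Definition price_process : Prop :=
  forall t, (t <= T)%N -> ext_range j (F t) (S t) /\ 0 <= S t.

Definition gains (t : nat) : set Eu := [set v |
  exists2 theta : nat -> Eu,
    (forall i, (t <= i < T)%N -> ext_range j (F i) (theta i)) &
    v = \sum_(t.+1 <= i < T.+1) mul (theta i.-1) (S i - S i.-1)].

Definition superhedging_prices (t : nat) : set Eu := [set p |
  ext_range j (F t) p /\ exists2 v, gains t v & 0 <= p + v].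

Definition AIP : Prop :=
  forall t, (t < T)%N ->
    superhedging_prices t `&` [set p | ext_range j (F t) p /\ p <= 0]
    = [set 0].

End Market.

(* Main.v *)
(* The range R(F) of the extended conditional expectation consists of the
   elements of E^u whose truncations at the levels n e lie in the range of F.
   Since F is strictly positive, its range is closed under order bounded
   suprema, so R(F) is closed under all suprema existing in E^u, under the
   lattice operations, and hence under multiplication by the component of e in
   the band generated by a positive element of R(F).
   If g <= v with g in R(F_t) and v in V_{t,T}, let p be the component of e in
   the band generated by g^+.  Then g^+ = p g <= p v, and p v is again in
   V_{t,T}, because p theta_i is in R(F_i); so -g^+ is an immediate profit
   unless g <= 0.  The converse is a change of sign. *)
Require Import Defs.
From HB Require Import structures.
From mathcomp Require Import all_boot all_order all_algebra.
From mathcomp Require Import boolp classical_sets reals.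

Import Order.TTheory GRing.Theory.

Local Open Scope classical_set_scope.
Local Open Scope ring_scope.

(** * Order and lattice arithmetic in Riesz spaces, suprema and the Archimedean property *)

Section RieszSpace.
Set Implicit Arguments.
Unset Strict Implicit.
Variables (R : realType) (E : rieszType R).
Implicit Types (x y z a : E) (D : set E).

Lemma riesz_leD2r z x y : (x + z <= y + z) = (x <= y).
Proof.
apply/idP/idP; last exact: riesz_leD2r.
by move/(@Defs.riesz_leD2r _ E (- z)); rewrite !addrK.
Qed.

Lemma riesz_subr_ge0 x y : (0 <= y - x) = (x <= y).
Proof. by rewrite -(riesz_leD2r x 0) add0r subrK. Qed.

Lemma riesz_subr_le0 x y : (y - x <= 0) = (y <= x).
Proof. by rewrite -(riesz_leD2r x _ 0) add0r subrK. Qed.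

Lemma riesz_lerBlDr x y z : (x - y <= z) = (x <= z + y).
Proof. by rewrite -(riesz_leD2r y (_ - _)) subrK. Qed.

Lemma riesz_lerBrDr x y z : (x <= y - z) = (x + z <= y).
Proof. by rewrite -(riesz_leD2r z _ (_ - _)) subrK. Qed.

Lemma riesz_lerN2 x y : (- x <= - y) = (y <= x).
Proof. by rewrite -(riesz_subr_ge0 (- x)) opprK addrC riesz_subr_ge0. Qed.

Lemma riesz_lerNr x y : (x <= - y) = (y <= - x).
Proof. by rewrite -riesz_lerN2 opprK. Qed.

Lemma riesz_oppr_le0 x : (- x <= 0) = (0 <= x).
Proof. by rewrite -{1}oppr0 riesz_lerN2. Qed.

Lemma riesz_lerD x y z a : x <= y -> z <= a -> x + z <= y + a.
Proof.
move=> xy za; apply: (@le_trans _ _ (y + z)); first by rewrite riesz_leD2r.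
by rewrite ![y + _]addrC riesz_leD2r.
Qed.

Lemma riesz_addr_ge0 x y : 0 <= x -> 0 <= y -> 0 <= x + y.
Proof. by move=> x0 y0; rewrite -[0]addr0; apply: riesz_lerD. Qed.

Lemma riesz_mulrn_ge0 x n : 0 <= x -> 0 <= x *+ n.
Proof.
by move=> x0; elim: n => // n IH; rewrite mulrS; apply: riesz_addr_ge0.
Qed.

Lemma riesz_mulrn_le x m n : 0 <= x -> (m <= n)%N -> x *+ m <= x *+ n.
Proof.
move=> x0 mn; rewrite -riesz_subr_ge0 -mulrnBr //.
exact: riesz_mulrn_ge0.
Qed.

Lemma riesz_lerMn2r x y n : x <= y -> x *+ n <= y *+ n.
Proof.
by move=> xy; elim: n => // n IH; rewrite !mulrS; apply: riesz_lerD.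
Qed.

Lemma addr_joinl x y z : ((x `|` y) + z = (x + z) `|` (y + z))%O.
Proof.
apply/le_anti/andP; split; last by rewrite leUx !riesz_leD2r leUl leUr.
by rewrite -riesz_lerBrDr leUx !riesz_lerBrDr leUl leUr.
Qed.

Lemma oppr_join x y : - (x `|` y)%O = (- x `&` - y)%O.
Proof.
apply/le_anti/andP; split; first by rewrite lexI !riesz_lerN2 leUl leUr.
rewrite -[leLHS]opprK riesz_lerN2 leUx.
by rewrite !(riesz_lerNr _ (_ `&` _)%O) leIl leIr.
Qed.

Lemma oppr_meet x y : - (x `&` y)%O = (- x `|` - y)%O.
Proof. by rewrite -[RHS]opprK oppr_join !opprK. Qed.

Lemma join_add_meet x y : (x `|` y)%O + (x `&` y)%O = x + y.
Proof.
apply: (addIr (- (x `&` y)%O)); rewrite addrK oppr_meet [RHS]addrC addr_joinl.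
by rewrite addKr [x + y]addrC addKr joinC.
Qed.

Lemma rpos_ge0 x : 0 <= rpos x. Proof. exact: leUr. Qed.

Lemma rneg_ge0 x : 0 <= rneg x. Proof. exact: leUr. Qed.

Lemma rpos_sub_rneg x : rpos x - rneg x = x.
Proof.
rewrite /rneg -[in X in (_ `|` X)%O]oppr0 -oppr_meet opprK join_add_meet.
by rewrite addr0.
Qed.

Lemma meet_rpos_rneg x : (rpos x `&` rneg x)%O = 0.
Proof.
apply: (addrI (rpos x `|` rneg x)%O); rewrite join_add_meet addr0.
(* By translation, the join of the two parts is already their sum, which leaves 0 for the meet. *)
have -> : (rpos x `|` rneg x)%O = ((rpos x - rneg x) `|` 0)%O + rneg x.
  by rewrite addr_joinl subrK add0r.
by rewrite rpos_sub_rneg.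
Qed.

(** The identity s /\ a = s + a - s \/ a turns a bound on the meet into a bound on [s] alone, to
    which leastness of [s] applies. *)
Lemma supremums_meet D s a :
  supremums D s -> supremums ((fun x => (x `&` a)%O) @` D) (s `&` a)%O.
Proof.
case=> ubs lubs; split.
  by move=> _ [x Dx <-]; rewrite leI2 // ubs.
move=> u ubu.
have -> : (s `&` a)%O = s + a - (s `|` a)%O.
  by rewrite -(join_add_meet s a) addrC addKr.
rewrite riesz_lerBlDr -riesz_lerBrDr; apply: lubs => x Dx.
rewrite riesz_lerBrDr -(join_add_meet x a) addrC; apply: riesz_lerD.
  by apply: ubu; exists x.
by rewrite leU2 // ubs.
Qed.

Lemma riesz_meetUl x y a : ((x `|` y) `&` a = (x `&` a) `|` (y `&` a))%O.
Proof.
have /(supremums_meet a)[ub lub] : supremums [set x; y] (x `|` y)%O.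
  split=> [_ [->|->]|u ubu]; rewrite ?leUl ?leUr //.
  by rewrite leUx !ubu //; [right|left].
apply/le_anti/andP; split.
  by apply: lub => _ [_ [->|->] <-]; rewrite ?leUl ?leUr.
by rewrite leUx !ub //; [exists y => //; right|exists x => //; left].
Qed.

Lemma riesz_joinIl x y a : ((x `&` y) `|` a = (x `|` a) `&` (y `|` a))%O.
Proof.
by apply: oppr_inj; rewrite oppr_join !oppr_meet riesz_meetUl !oppr_join.
Qed.

(** Nonemptiness of [D] is what places [a] itself below every upper bound of the joins. *)
Lemma supremums_join D s a : D !=set0 ->
  supremums D s -> supremums ((fun x => (x `|` a)%O) @` D) (s `|` a)%O.
Proof.
move=> [x0 Dx0] [ubs lubs]; split.
  by move=> _ [x Dx <-]; rewrite leU2 // ubs.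
move=> u ubu; rewrite leUx; apply/andP; split.
  by apply: lubs => x Dx; apply: (le_trans (leUl x a)); apply: ubu; exists x.
by apply: (le_trans (leUr a x0)); apply: ubu; exists x0.
Qed.

Lemma supremums_exist D b : dedekind_complete [set: E] ->
  D !=set0 -> ubound D b -> exists s, supremums D s.
Proof.
move=> Ec D0 ubb; have [] := Ec D (fun _ _ => I) D0; first by exists b.
by move=> s [_ ubs lubs]; exists s; split=> // u ubu; exact: lubs.
Qed.

Lemma supremums_add D s a :
  supremums D s -> supremums ((fun x => x + a) @` D) (s + a).
Proof.
case=> ubs lubs; split; first by move=> _ [x Dx <-]; rewrite riesz_leD2r ubs.
move=> u ubu; rewrite -riesz_lerBrDr; apply: lubs => x Dx.
by rewrite riesz_lerBrDr; apply: ubu; exists x.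
Qed.

Lemma archimedean x y : dedekind_complete [set: E] ->
  (forall n, x *+ n <= y) -> x <= 0.
Proof.
move=> Ec xy; pose D : set E := range (fun n => x *+ n).
have [|||s [ubs lubs]] := @supremums_exist D y => //.
- by exists (x *+ 0), 0%N.
- by move=> _ [n _ <-].
(* [s - x] also bounds the multiples, because adding [x] to one multiple gives the next. *)
suff: s <= s - x by rewrite riesz_lerBrDr -[X in _ <= X]add0r addrC riesz_leD2r.
apply: lubs => // _ [n _ <-]; rewrite riesz_lerBrDr -mulrSr.
by apply: ubs; exists n.+1.
Qed.

End RieszSpace.

(** * Products and supports in a Dedekind complete f-algebra *)

Section FAlgebra.
Set Implicit Arguments.
Unset Strict Implicit.
Variables (R : realType) (A : rieszType R) (one : A) (mul : A -> A -> A).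
Hypothesis A_falg : f_algebra one mul.
Hypothesis A_complete : dedekind_complete [set: A].
Hypothesis one_ge0 : 0 <= one.
Implicit Types (x y z w : A).

Let mull y : {linear A -> A} :=
  HB.pack (mul^~ y) (GRing.isLinear.Build _ _ _ _ _ (falg_linearl A_falg y)).
Let mulr x : {linear A -> A} :=
  HB.pack (mul x) (GRing.isLinear.Build _ _ _ _ _ (falg_linearr A_falg x)).

Lemma falg_mulBl z : {morph mul^~ z : x y / x - y}.
Proof. exact: (linearB (mull z)). Qed.

Lemma falg_mulBr z : {morph mul z : x y / x - y}.
Proof. exact: (linearB (mulr z)). Qed.

Lemma falg_mul0l z : mul 0 z = 0.
Proof. exact: (linear0 (mull z)). Qed.

Lemma falg_mulMnl z n : {morph mul^~ z : x / x *+ n}.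
Proof. exact: (linearMn (mull z)). Qed.

Lemma falg_mulMnr z n : {morph mul z : x / x *+ n}.
Proof. exact: (linearMn (mulr z)). Qed.

Lemma falg_mul_sumr z (I : Type) (r : seq I) (P : pred I) (f : I -> A) :
  mul z (\sum_(i <- r | P i) f i) = \sum_(i <- r | P i) mul z (f i).
Proof. exact: (linear_sum (mulr z)). Qed.

Lemma falg_ler_mull z x y : 0 <= z -> x <= y -> mul z x <= mul z y.
Proof.
move=> z0 xy; rewrite -riesz_subr_ge0 -falg_mulBr.
by apply: (falg_mul_ge0 A_falg) => //; rewrite riesz_subr_ge0.
Qed.

Lemma falg_ler_mulr z x y : 0 <= z -> x <= y -> mul x z <= mul y z.
Proof.
move=> z0 xy; rewrite -riesz_subr_ge0 -falg_mulBl.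
by apply: (falg_mul_ge0 A_falg) => //; rewrite riesz_subr_ge0.
Qed.

(** Multiplication by a positive element preserves disjointness: the product is disjoint from [y],
    and then from itself. *)
Lemma falg_disjoint_mul x y :
  0 <= x -> 0 <= y -> (x `&` y)%O = 0 -> mul x y = 0.
Proof.
move=> x0 y0 xy; have := falg_disjr A_falg xy y0.
by rewrite meetC => /(falg_disjl A_falg)/(_ x0); rewrite meetxx.
Qed.

Lemma falg_mul_rposl x : mul x (rpos x) = mul (rpos x) (rpos x).
Proof.
rewrite -{1}(rpos_sub_rneg x) falg_mulBl.
rewrite (@falg_disjoint_mul (rneg x)) ?subr0 //; first exact: rneg_ge0.
  exact: rpos_ge0.
by rewrite meetC meet_rpos_rneg.
Qed.

(* With a := (w - n)^+ one has n a <= w a <= w w, so a tends to 0 as n grows. *)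
Lemma falg_unit_archimedean w u :
  0 <= w -> (forall n, (w `&` one *+ n)%O <= u) -> w <= u.
Proof.
move=> w0 wu; rewrite -riesz_subr_le0.
apply: (@archimedean _ _ _ (mul w w)) => // n.
set a := rpos (w - one *+ n).
have wa : w - a = (w `&` one *+ n)%O.
  rewrite /a /rpos -(subrr (one *+ n)) -addr_joinl opprB addrA.
  by rewrite -(join_add_meet w (one *+ n)) addrC addKr.
apply: (@le_trans _ _ (a *+ n)).
  by apply: riesz_lerMn2r; rewrite riesz_lerBlDr addrC -riesz_lerBlDr wa.
have a0 : 0 <= a by exact: rpos_ge0.
apply: (@le_trans _ _ (mul w a)); last first.
  apply: falg_ler_mull => //; rewrite -riesz_subr_ge0 wa lexI w0.
  exact: riesz_mulrn_ge0.
rewrite -[a in a *+ n](falg_mul1l A_falg) -falg_mulMnl -riesz_subr_ge0.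
rewrite -falg_mulBl falg_mul_rposl.
exact: (falg_mul_ge0 A_falg).
Qed.

(* [p] is the component of [one] in the band generated by [x]. *)
Lemma falg_support x : 0 <= x ->
  exists p, [/\ supremums (range (fun n => (one `&` x *+ n)%O)) p,
    0 <= p <= one, mul p x = x, mul (one - p) p = 0 &
    forall y, 0 <= y -> (x `&` y)%O = 0 -> (p `&` y)%O = 0].
Proof.
move=> x0; pose D : set A := range (fun n => (one `&` x *+ n)%O).
have [|||p supp] := @supremums_exist _ _ D one => //.
- by exists (one `&` x *+ 0)%O, 0%N.
- by move=> _ [n _ <-]; exact: leIl.
have [ubp lubp] := supp.
have p0 : 0 <= p.
  by apply: ubp; exists 0%N => //; rewrite mulr0n meet_r.
have p1 : p <= one by apply: lubp => // _ [n _ <-]; exact: leIl.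
have disj y : 0 <= y -> (x `&` y)%O = 0 -> (p `&` y)%O = 0.
  move=> y0 xy; apply/le_anti; rewrite [X in _ && X]lexI p0 y0 !andbT.
  apply: (supremums_meet y supp).2 => _ [_ [n _ <-] <-].
  (* The multiple [x *+ n] is the product of [x] with [one *+ n], so it stays disjoint from [y]. *)
  have <- : (x *+ n `&` y)%O = 0.
    have := falg_disjr A_falg xy (riesz_mulrn_ge0 n one_ge0).
    by rewrite falg_mulMnr (falg_mul1r A_falg).
  by rewrite leI2 // leIr.
have q0 : 0 <= one - p by rewrite riesz_subr_ge0.
(* Disjoint positive elements have product 0, so this single disjointness yields both product
   identities, the second through [disj]. *)
suff xq : (x `&` (one - p))%O = 0.
  exists p; split=> //; first by rewrite p0.
    apply/esym/eqP; rewrite -subr_eq0 -[X in X - _](falg_mul1l A_falg).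
    by rewrite -falg_mulBl falg_disjoint_mul // meetC.
  by rewrite falg_disjoint_mul // meetC disj.
set z := (x `&` (one - p))%O; apply/le_anti; rewrite [X in _ && X]lexI x0 q0.
(* Since z <= x and z <= one - p, adding [z] to the term of index n stays below the term of index n
   + 1. Hence p <= p - z, which forces z <= 0. *)
rewrite !andbT -(riesz_leD2r p) add0r addrC -riesz_lerBrDr; apply: lubp => //.
move=> _ [n _ <-]; rewrite riesz_lerBrDr.
apply: (@le_trans _ _ (one `&` x *+ n.+1)%O).
  rewrite lexI; apply/andP; split.
    rewrite -[leRHS](subrK p) addrC riesz_lerD ?leIr //.
    by apply: ubp; exists n.
  by rewrite mulrS addrC riesz_lerD ?leIl ?leIr.
by apply: ubp; exists n.+1.
Qed.

(** Multiplication by [p] is the projection onto the band of [p]. This formula expresses it through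
    multiples, meets and suprema, so closure under those operations gives closure under
    multiplication by [p]. *)
Lemma falg_support_mul p y : 0 <= p -> p <= one -> mul (one - p) p = 0 ->
  0 <= y -> supremums (range (fun n => (y `&` p *+ n)%O)) (mul p y).
Proof.
move=> p0 p1 qp0 y0.
have q0 : 0 <= one - p by rewrite riesz_subr_ge0.
(* (one - p) z lies between 0 and (one - p) w = 0, so [p] fixes [z]. *)
have fixp z w : 0 <= z -> z <= w -> mul (one - p) w = 0 -> mul p z = z.
  move=> z0 zw qw; apply/esym/eqP; rewrite -subr_eq0.
  rewrite -[X in X - _](falg_mul1l A_falg) -falg_mulBl; apply/eqP/le_anti.
  by rewrite (falg_mul_ge0 A_falg) // -qw falg_ler_mull.
have py0 : 0 <= mul p y by exact: (falg_mul_ge0 A_falg).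
split.
  move=> _ [n _ <-].
  rewrite -(@fixp (y `&` p *+ n)%O (p *+ n)) ?leIr ?lexI ?y0
    ?riesz_mulrn_ge0 //.
    by rewrite falg_ler_mull // leIl.
  by rewrite falg_mulMnr qp0 mul0rn.
(* It suffices to bound the truncations of [mul p y]. Each is fixed by [p], so being below
   [one *+ n] it is also below [p *+ n]. *)
move=> u ubu; apply: falg_unit_archimedean => // n.
apply: (@le_trans _ _ (y `&` p *+ n)%O); last by apply: ubu; exists n.
have pyn0 : 0 <= (mul p y `&` one *+ n)%O.
  by rewrite lexI py0 riesz_mulrn_ge0.
rewrite lexI; apply/andP; split.
  apply: (le_trans (leIl _ _)).
  by rewrite -[leRHS](falg_mul1l A_falg) falg_ler_mulr.
rewrite -(@fixp _ _ pyn0 (leIl _ _)).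
  rewrite -[in leRHS](falg_mul1r A_falg p) -falg_mulMnr.
  by rewrite falg_ler_mull // leIr.
by rewrite (falg_mulA A_falg) qp0 falg_mul0l.
Qed.

(** * Truncation between opposite multiples of the unit *)

Definition clip n w : A := ((w `&` one *+ n) `|` - (one *+ n))%O.

(* For [L = j @` range F] this is the range of the extension of [F], see
   [ext_rangeE]. *)
Definition clip_closure (L : set A) : set A := [set w | forall n, L (clip n w)].

(** The bound is taken in [L] so that, when [L] is an embedded copy of part of [E], it yields a
    bound in [E], where the supremum can be formed. *)
Definition closed_bounded_sup (L : set A) : Prop := forall (D : set A) s l,
  D `<=` L -> D !=set0 -> supremums D s -> L l -> s <= l -> L s.

(** The upper and lower truncations commute because - (one *+ n) <= one *+ n. *)
Lemma clipN n w : clip n (- w) = - clip n w.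
Proof.
rewrite /clip oppr_join oppr_meet opprK riesz_joinIl.
rewrite [X in (_ `&` X)%O]join_l //.
apply: (@le_trans _ _ 0); last exact: riesz_mulrn_ge0.
by rewrite riesz_oppr_le0 riesz_mulrn_ge0.
Qed.

Lemma clip_meet n x y : clip n (x `&` y)%O = (clip n x `&` clip n y)%O.
Proof. by rewrite /clip -riesz_joinIl meetACA meetxx. Qed.

Lemma clip_ge0 n w : 0 <= w -> clip n w = (w `&` one *+ n)%O.
Proof.
move=> w0; apply: join_l; apply: (@le_trans _ _ 0).
  by rewrite riesz_oppr_le0 riesz_mulrn_ge0.
by rewrite lexI w0 riesz_mulrn_ge0.
Qed.

Lemma clip_le n w : clip n w <= one *+ n.
Proof.
rewrite leUx leIr /=; apply: (@le_trans _ _ 0); last exact: riesz_mulrn_ge0.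
by rewrite riesz_oppr_le0 riesz_mulrn_ge0.
Qed.

Lemma supremums_clip D s n : D !=set0 ->
  supremums D s -> supremums (clip n @` D) (clip n s).
Proof.
move=> [d Dd] Ds; rewrite /clip -(image_comp _ (fun x => x `|` _)%O).
by apply: supremums_join; [exact: image_nonempty (ex_intro _ d Dd)|
  exact: supremums_meet].
Qed.

Lemma supremums_meet_unit w : 0 <= w ->
  supremums (range (fun n => (w `&` one *+ n)%O)) w.
Proof.
move=> w0; split; first by move=> _ [n _ <-]; exact: leIl.
by move=> u ubu; apply: falg_unit_archimedean => // n; apply: ubu; exists n.
Qed.

(** * Closure properties of the elements whose truncations all lie in [L] *)

Section ClipClosure.
Variable L : set A.
Hypothesis L_riesz : riesz_subspace L.
Hypothesis L_one : L one.
Hypothesis L_sup : closed_bounded_sup L.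

Let LD x y : L x -> L y -> L (x + y).
Proof. by move=> Lx Ly; rewrite -[x]scale1r; apply: L_riesz.1.2. Qed.

Let LN x : L x -> L (- x).
Proof.
move=> Lx; rewrite -[- x]addr0 -scaleN1r.
by apply: L_riesz.1.2 => //; exact: L_riesz.1.1.
Qed.

Let Ln n : L (one *+ n).
Proof.
by elim: n => [|n IH]; [exact: L_riesz.1.1|rewrite mulrS; exact: LD].
Qed.

Lemma sub_clip_closure : L `<=` clip_closure L.
Proof.
move=> w Lw n; apply: (L_riesz.2 _ _ _ _).1; last exact: LN.
exact: (L_riesz.2 _ _ _ _).2.
Qed.

Lemma clip_closureN w : clip_closure L w -> clip_closure L (- w).
Proof. by move=> Mw n; rewrite clipN; apply: LN. Qed.

Lemma clip_closure_meet x y :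
  clip_closure L x -> clip_closure L y -> clip_closure L (x `&` y)%O.
Proof. by move=> Mx My n; rewrite clip_meet; apply: (L_riesz.2 _ _ _ _).2. Qed.

Lemma clip_closure_join x y :
  clip_closure L x -> clip_closure L y -> clip_closure L (x `|` y)%O.
Proof.
move=> Mx My; rewrite -[(_ `|` _)%O]opprK oppr_join.
by apply/clip_closureN/clip_closure_meet; exact: clip_closureN.
Qed.

Lemma clip_closure_rpos w : clip_closure L w -> clip_closure L (rpos w).
Proof.
move=> Mw; apply: clip_closure_join => //.
exact/sub_clip_closure/L_riesz.1.1.
Qed.

Lemma clip_closure_rneg w : clip_closure L w -> clip_closure L (rneg w).
Proof. by move=> Mw; apply/clip_closure_rpos/clip_closureN. Qed.

(** Truncation commutes with suprema, and the truncated family is bounded by [one *+ n], which lies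
    in [L]; no bound on [D] itself in [L] has to be supplied. *)
Lemma clip_closure_sup D s : D `<=` clip_closure L -> D !=set0 ->
  supremums D s -> clip_closure L s.
Proof.
move=> DM D0 Ds n; apply: (L_sup _ _ (supremums_clip n D0 Ds) (Ln n)).
- by move=> _ [x Dx <-]; exact: DM.
- by have [d Dd] := D0; exists (clip n d), d.
- exact: clip_le.
Qed.

Lemma clip_closure_meet_unit w n :
  0 <= w -> clip_closure L w -> L (w `&` one *+ n)%O.
Proof. by move=> w0 Mw; rewrite -clip_ge0. Qed.

(** Truncation is not additive, so sums are reached through suprema: x + b is the supremum of the
    elements x /\ n one + b of [L]. Applying this to one summand at a time gives [clip_closureD]. *)
Let clip_closureDl x b : 0 <= x ->
  clip_closure L x -> L b -> clip_closure L (x + b).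
Proof.
move=> x0 Mx Lb; apply: clip_closure_sup (supremums_add b _); last first.
- exact: supremums_meet_unit x0.
- by exists ((x `&` one *+ 0)%O + b), (x `&` one *+ 0)%O => //; exists 0%N.
move=> _ [_ [n _ <-] <-]; apply/sub_clip_closure/LD => //.
exact: clip_closure_meet_unit.
Qed.

Lemma clip_closureD x y : 0 <= x -> 0 <= y ->
  clip_closure L x -> clip_closure L y -> clip_closure L (x + y).
Proof.
move=> x0 y0 Mx My; apply: clip_closure_sup (supremums_add y _); last first.
- exact: supremums_meet_unit x0.
- by exists ((x `&` one *+ 0)%O + y), (x `&` one *+ 0)%O => //; exists 0%N.
move=> _ [_ [n _ <-] <-]; rewrite addrC; apply: clip_closureDl => //.
exact: clip_closure_meet_unit.
Qed.

Lemma clip_closureB x y : 0 <= x -> 0 <= y ->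
  clip_closure L x -> clip_closure L y -> clip_closure L (x - y).
Proof.
move=> x0 y0 Mx My; apply: clip_closure_sup (supremums_add (- y) _); last first.
- exact: supremums_meet_unit x0.
- by exists ((x `&` one *+ 0)%O - y), (x `&` one *+ 0)%O => //; exists 0%N.
(* Each term is the opposite of y - (x /\ n one), a positive element plus an element of [L]. *)
move=> _ [_ [n _ <-] <-]; rewrite -opprB.
apply/clip_closureN/clip_closureDl => //.
exact/LN/clip_closure_meet_unit.
Qed.

Lemma clip_closureMn x n :
  0 <= x -> clip_closure L x -> clip_closure L (x *+ n).
Proof.
move=> x0 Mx; elim: n => [|n IH]; first exact/sub_clip_closure/L_riesz.1.1.
by rewrite mulrS; apply: clip_closureD => //; exact: riesz_mulrn_ge0.
Qed.

Lemma clip_closure_support x p : 0 <= x -> clip_closure L x ->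
  supremums (range (fun n => (one `&` x *+ n)%O)) p -> clip_closure L p.
Proof.
move=> x0 Mx; apply: clip_closure_sup.
  move=> _ [n _ <-]; apply: clip_closure_meet; first exact: sub_clip_closure.
  exact: clip_closureMn.
by exists (one `&` x *+ 0)%O, 0%N.
Qed.

(** For a positive factor the product is a supremum of meets with multiples of [p]; a general factor
    is split into its positive and negative parts. *)
Lemma clip_closure_mul_support p y : 0 <= p -> p <= one ->
  mul (one - p) p = 0 -> clip_closure L p ->
  clip_closure L y -> clip_closure L (mul p y).
Proof.
move=> p0 p1 pq Mp.
have pos z : 0 <= z -> clip_closure L z -> clip_closure L (mul p z).
  move=> z0 Mz; apply: clip_closure_sup (falg_support_mul p0 p1 pq z0).
    move=> _ [n _ <-]; apply: clip_closure_meet => //.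
    exact: clip_closureMn.
  by exists (z `&` p *+ 0)%O, 0%N.
move=> My; rewrite -(rpos_sub_rneg y) falg_mulBr; apply: clip_closureB.
- by apply: (falg_mul_ge0 A_falg) => //; exact: rpos_ge0.
- by apply: (falg_mul_ge0 A_falg) => //; exact: rneg_ge0.
- by apply: pos; [exact: rpos_ge0|exact: clip_closure_rpos].
- by apply: pos; [exact: rneg_ge0|exact: clip_closure_rneg].
Qed.

End ClipClosure.

End FAlgebra.

(** * Identification of the range of the extended conditional expectation *)

Section RangeExtension.
Set Implicit Arguments.
Unset Strict Implicit.
Variables (R : realType) (E Eu : rieszType R) (mul : Eu -> Eu -> Eu).
Variables (j : {linear E -> Eu}) (e : E).
Hypothesis E_complete : dedekind_complete [set: E].
Hypothesis j_completion : universal_completion j.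
Hypothesis Eu_falgebra : f_algebra (j e) mul.
Hypothesis e_ge0 : 0 <= e.

Let Eu_complete : dedekind_complete [set: Eu].
Proof. by case: j_completion => -[]. Qed.

(** The order is encoded by meets, which [j] preserves, and injectivity reflects the resulting
    equality. *)
Lemma completion_le x y : (j x <= j y) = (x <= y).
Proof.
case: j_completion => _ j_inj _ jI _.
by rewrite -!eq_meetl -jI (inj_eq j_inj).
Qed.

Lemma completion_ge0 x : (0 <= j x) = (0 <= x).
Proof. by rewrite -completion_le linear0. Qed.

(** If an upper bound [u] were not above [j s], order density would give x > 0 with j x <= j s - (j
    s /\ u); then s - x would still bound [D], against leastness of [s]. *)
Lemma completion_supremums D s : supremums D s -> supremums (j @` D) (j s).
Proof.
move=> [ubs lubs]; split.
  by move=> _ [x Dx <-]; rewrite completion_le ubs.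
move=> u ubu; apply/negP => /negP su.
case: j_completion => _ _ _ _ j_dense.
have [|x x0 xle] := j_dense (j s - (j s `&` u)%O).
  rewrite lt_neqAle riesz_subr_ge0 leIl andbT eq_sym subr_eq0 eq_sym.
  by rewrite eq_meetl.
have : s <= s - x.
  apply: lubs => d Dd; rewrite -completion_le linearB /= riesz_lerBrDr addrC.
  rewrite -riesz_lerBrDr; apply: (le_trans xle).
  rewrite -(riesz_lerN2 (_ - _)) !opprB riesz_leD2r lexI completion_le ubs //.
  by apply: ubu; exists d.
rewrite riesz_lerBrDr addrC -riesz_lerBrDr subrr -completion_le linear0.
by move=> x0'; have := lt_le_trans x0 x0'; rewrite ltxx.
Qed.

Variable F : {linear E -> E}.
Hypothesis F_cond : conditional_expectation e F.

Lemma cond_exp_id x : range F x -> F x = x.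
Proof. by case: F_cond => _ _ FF _ _ [y _ <-]. Qed.

Lemma cond_exp_le x y : x <= y -> F x <= F y.
Proof.
case: F_cond => F0 _ _ _ _; rewrite -riesz_subr_ge0 -(riesz_subr_ge0 (F x)).
rewrite -linearB le_eqVlt => /predU1P[<-|/F0/ltW//].
by rewrite linear0.
Qed.

(* If [s] is a supremum of fixed points of [F] then [s <= F s], and these two
   elements have the same image under [F], which is strictly positive. *)
Lemma cond_exp_range_sup D s :
  D `<=` range F -> supremums D s -> range F s.
Proof.
case: (F_cond) => F0 _ FF _ _ DF [ubs lubs].
have sFs : s <= F s.
  apply: lubs => d Dd; rewrite -(cond_exp_id (DF _ Dd)).
  exact/cond_exp_le/ubs.
exists s => //; apply/eqP; apply/negPn/negP => Fs.
have /F0 : 0 < F s - s.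
  by rewrite lt_neqAle riesz_subr_ge0 sFs eq_sym subr_eq0 Fs.
by rewrite linearB /= FF subrr ltxx.
Qed.

Definition embedded_range : set Eu := j @` range F.

Lemma embedded_range_riesz : riesz_subspace embedded_range.
Proof.
case: F_cond => _ _ _ _ [[[r0 rZ] rL] _].
case: j_completion => _ _ jU jI _.
split; [split|].
- by exists 0; rewrite ?linear0.
- move=> a _ _ [x rx <-] [y ry <-]; exists (a *: x + y); last exact: linearP.
  exact: rZ.
- move=> _ _ [x rx <-] [y ry <-]; have [rU rI] := rL _ _ rx ry.
  by split; [exists (x `|` y)%O|exists (x `&` y)%O].
Qed.

Lemma embedded_range_unit : embedded_range (j e).
Proof. by case: F_cond => _ _ _ Fe _; exists e => //; exists e. Qed.

(** The supremum is formed in [E], for the preimage of [D], and carried over by [j], which preserves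
    suprema. *)
Lemma embedded_range_sup : closed_bounded_sup embedded_range.
Proof.
move=> D s l DF [d0 Dd0] [ubs lubs] [y _ <-] sy.
have [x0 rx0 jx0] := DF _ Dd0.
pose D' : set E := [set x | range F x /\ D (j x)].
have D'E : j @` D' = D.
  apply/seteqP; split => [_ [x [_ Dx] <-] //|d Dd].
  by have [x rx jx] := DF _ Dd; exists x => //; split=> //; rewrite jx.
have [|||t Dt] := @supremums_exist _ _ D' y => //.
- by exists x0; split=> //; rewrite jx0.
- by move=> x [_ Dx]; rewrite -completion_le (le_trans _ sy) // ubs.
have [ubt lubt] := completion_supremums Dt; rewrite D'E in ubt lubt.
exists t; first by apply: cond_exp_range_sup Dt => x [].
by apply/le_anti; rewrite lubt //= lubs.
Qed.

Let clipc := clip_closure (j e) embedded_range.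
Let je_ge0 : 0 <= j e. Proof. by rewrite completion_ge0. Qed.
Let Lr := embedded_range_riesz.
Let Lu := embedded_range_unit.
Let Ls := embedded_range_sup.

(** The truncations of [w] come from fixed points of [F] that increase to [w], so the extension is
    defined at [w] and fixes it. *)
Lemma clip_closure_ext_pos w : 0 <= w -> clipc w ->
  natural_domain_pos j F w /\ ext_pos j F w w.
Proof.
move=> w0 Mw.
have /choice[r rP] : forall n, exists x, range F x /\ j x = (w `&` j e *+ n)%O.
  move=> n; have [x rx jx] := clip_closure_meet_unit je_ge0 n w0 Mw.
  by exists x.
have Fr n : F (r n) = r n by apply: cond_exp_id; exact: (rP n).1.
have jr : range (j \o r) = range (fun n => (w `&` j e *+ n)%O).
  by apply: eq_imagel => n _ /=; rewrite (rP n).2.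
have jFr : range (j \o (F \o r)) = range (j \o r).
  by apply: eq_imagel => n _ /=; rewrite Fr.
have sup_r : supremums (range (j \o r)) w.
  by rewrite jr; apply: (supremums_meet_unit Eu_falgebra).
have net : net_increases_to j (fun m n : nat => (m <= n)%N) r w.
  split=> //.
  - split=> [||k m n|m n]; first exact: (inhabits 0%N); first exact: leqnn.
      exact: leq_trans.
    by exists (maxn m n); rewrite leq_maxl leq_maxr.
  - move=> n; rewrite -completion_ge0 (rP n).2 lexI w0.
    exact: riesz_mulrn_ge0.
  - move=> m n mn; rewrite -completion_le !(rP _).2 leI2 //.
    exact: riesz_mulrn_le.
split; first split=> //.
  exists nat, (fun m n : nat => (m <= n)%N), r; split=> //.
  by rewrite jFr; exists w; exact: sup_r.1.
by exists nat, (fun m n : nat => (m <= n)%N), r; rewrite jFr.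
Qed.

(** A value of the extension is a supremum of elements of the embedded range, and the closure
    contains such suprema. *)
Lemma ext_pos_clip_closure z w : ext_pos j F z w -> 0 <= w /\ clipc w.
Proof.
move=> [I [leI [x [[[[i0] _ _ _] x0 _ _] Fx_sup]]]].
have Fx0 i : 0 <= j (F (x i)).
  by rewrite completion_ge0 -(linear0 F) cond_exp_le.
split; first by apply: (le_trans (Fx0 i0)); apply: Fx_sup.1; exists i0.
apply: (clip_closure_sup je_ge0 Lr Lu Ls _ _ Fx_sup) => //.
  move=> _ [i _ <-]; apply: (sub_clip_closure Lr Lu).
  by exists (F (x i)) => //; exists (x i).
by exists (j (F (x i0))), i0.
Qed.

Lemma ext_rangeE : ext_range j F = clipc.
Proof.
apply/seteqP; split => [w [z _ [w1 [w2 [zw1 zw2 ->]]]]|w Mw].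
  have [w10 Mw1] := ext_pos_clip_closure zw1.
  have [w20 Mw2] := ext_pos_clip_closure zw2.
  exact: (clip_closureB Eu_falgebra).
have [] := clip_closure_ext_pos (rpos_ge0 w)
  (clip_closure_rpos je_ge0 Lr Lu Mw).
have [] := clip_closure_ext_pos (rneg_ge0 w)
  (clip_closure_rneg je_ge0 Lr Lu Mw).
move=> dn en dp ep; exists w; first by [].
by exists (rpos w), (rneg w); rewrite rpos_sub_rneg.
Qed.

End RangeExtension.

Theorem lemma28 (R : realType) (E Eu : rieszType R)
    (mul : Eu -> Eu -> Eu) (j : {linear E -> Eu}) (e : E) (T : nat)
    (F : nat -> {linear E -> E}) (S : nat -> Eu)
    (E_complete : dedekind_complete [set: E])
    (e_unit : weak_order_unit e)
    (j_completion : universal_completion j)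
    (Eu_falgebra : f_algebra (j e) mul)
    (T_ge1 : (1 <= T)%N)
    (F_filtration : filtration e T F)
    (S_price : price_process j T F S) :
  AIP mul j T F S <->
  (forall (t : nat) (v : Eu), (t <= T)%N -> gains mul j T F S t v ->
     cond_inf_le0 j (F t) v).
Proof.
have [e0 _] := e_unit.
have je0 : 0 <= j e by rewrite (completion_ge0 j_completion).
have Eu_complete : dedekind_complete [set: Eu] by case: j_completion => -[].
have [F_cond F_comp] := F_filtration.
pose L t := embedded_range j (F t).
have Lr t : (t <= T)%N -> riesz_subspace (L t).
  by move=> /F_cond Ft; exact: (embedded_range_riesz j_completion Ft).
have Lu t : (t <= T)%N -> L t (j e).
  by move=> /F_cond Ft; exact: (embedded_range_unit j Ft).
have Ls t : (t <= T)%N -> closed_bounded_sup (L t).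
  by move=> /F_cond Ft; exact: (embedded_range_sup E_complete j_completion Ft).
have rangeE t : (t <= T)%N -> ext_range j (F t) = clip_closure (j e) (L t).
  move=> /F_cond Ft.
  exact: (ext_rangeE E_complete j_completion Eu_falgebra e0 Ft).
have zeroR t : (t <= T)%N -> ext_range j (F t) 0.
  move=> tT; rewrite rangeE //; apply: (sub_clip_closure (Lr t tT) (Lu t tT)).
  exact: (Lr t tT).1.1.
have monoR t i : (t <= i <= T)%N -> ext_range j (F t) `<=` ext_range j (F i).
  case/andP; rewrite leq_eqVlt => /predU1P[->|ti] iT w //.
  rewrite (rangeE i iT) (rangeE t (leq_trans (ltnW ti) iT)) => Mw n.
  have [x [y _ <-] <-] := Mw n.
  (* [F i] fixes the range of [F t], so the element serves as its own preimage. *)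
  exists (F t y) => //; exists (F t y) => //.
  exact: (F_comp _ _ ti iT y).2.
split=> [aip t v | cinf t tT].
  rewrite leq_eqVlt => /predU1P[->|tT] [theta theta_adapted ->] g Rg gv.
    (* At t = T the sum of gains is empty, and [gv] already says g <= 0. *)
    by move: gv; rewrite big_geq.
  have tT' := ltnW tT.
  move: (Rg); rewrite rangeE // => Mg.
  have Mgp := clip_closure_rpos je0 (Lr t tT') (Lu t tT') Mg.
  have [p [p_sup /andP[p0 p1] pg pq p_disj]] :=
    falg_support Eu_falgebra Eu_complete je0 (rpos_ge0 g).
  have Mp := clip_closure_support Eu_falgebra Eu_complete je0 (Lr t tT')
    (Lu t tT') (Ls t tT') (rpos_ge0 g) Mgp p_sup.
  (* [p] is disjoint from the negative part of [g], so only the positive part survives. *)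
  have pgE : mul p g = rpos g.
    rewrite -{1}(rpos_sub_rneg g) (falg_mulBr Eu_falgebra) pg.
    rewrite (falg_disjoint_mul Eu_falgebra p0 (rneg_ge0 g)) ?subr0 //.
    by apply: p_disj; [exact: rneg_ge0|exact: meet_rpos_rneg].
  have : [set 0] (- rpos g).
    rewrite -(aip t tT); split; last first.
      split; last by rewrite riesz_oppr_le0 rpos_ge0.
      by rewrite rangeE //; apply: clip_closureN Mgp => //; exact: Lr.
    split.
      by rewrite rangeE //; apply: clip_closureN Mgp => //; exact: Lr.
    exists (mul p (\sum_(t.+1 <= i < T.+1)
      mul (theta i.-1) (S i - S i.-1))); last first.
      by rewrite addrC riesz_subr_ge0 -pgE (falg_ler_mull Eu_falgebra).
    exists (fun i => mul p (theta i)); last first.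
      rewrite (falg_mul_sumr Eu_falgebra); apply: eq_bigr => i _.
      exact: (falg_mulA Eu_falgebra).
    move=> i /andP[ti iT]; have iT' := ltnW iT.
    rewrite rangeE //; apply: (clip_closure_mul_support Eu_falgebra Eu_complete
      je0 (Lr i iT') (Lu i iT') (Ls i iT') p0 p1 pq).
      (* [p] belongs to the range at time [t], hence to the larger range at time [i]. *)
      by rewrite -rangeE //; apply: (monoR t); rewrite ?ti // rangeE.
    by rewrite -rangeE //; apply: theta_adapted; rewrite ti.
  move=> /= /eqP; rewrite oppr_eq0 => /eqP gp0.
  by rewrite -gp0; exact: leUl.
have tT' := ltnW tT.
apply/seteqP; split => [p [[Rp [v vg pv]] [_ p_le0]]|_ ->]; last first.
  split; last by split; [exact: zeroR|].
  split; first exact: zeroR.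
  exists 0; last by rewrite addr0.
  (* The null strategy superhedges the price 0. *)
  exists (fun=> 0); first by move=> i /andP[_ /ltnW iT]; exact: zeroR.
  by rewrite big1 // => i _; exact: (falg_mul0l Eu_falgebra).
(* From 0 <= p + v, the element - p of the range lies below the gain [v], so the hypothesis gives -
   p <= 0. *)
apply/le_anti; rewrite p_le0 -riesz_oppr_le0 (cinf t v) //.
  move: Rp; rewrite rangeE //; apply: clip_closureN => //; exact: Lr.
by rewrite -riesz_subr_ge0 opprK addrC.
Qed.
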